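(* Let $K$ be any triangulation, as a simplicial complex, of the closed orientable surface of genus $3$ with exactly $10$ vertices (the minimum possible number of vertices for this surface; there are $20$ such triangulations up to combinatorial isomorphism). Then $K$ is geometrically realizable in $\mathbb{R}^3$.
   Context: A geometric (polyhedral) realization of a finite $2$-dimensional simplicial complex $K$ with vertex set $V$ in $\mathbb{R}^3$ is an injective map $p\colon V\to\mathbb{R}^3$ such that for every triangle $\{a,b,c\}$ of $K$ the points $p(a),p(b),p(c)$ are affinely independent, and for any two faces $\sigma,\tau$ of $K$ one has $\mathrm{conv}(p(\sigma))\cap\mathrm{conv}(p(\tau))=\mathrm{conv}(p(\sigma\cap\tau))$ (with $\mathrm{conv}(\emptyset)=\emptyset$). That is, straight edges, flat triangles, and no intersections other than along common faces. *)

(* Defs.v *)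
From HB Require Import structures.
From mathcomp Require Import all_boot all_order all_algebra.
From mathcomp Require Import reals.
Set Implicit Arguments. Unset Strict Implicit. Unset Printing Implicit Defensive.
Import Order.TTheory GRing.Theory Num.Theory.
Local Open Scope ring_scope.

(* A pure 2-dimensional complex on vertex set 'I_n is given by its set of
   triangles T; its faces are all subsets of triangles (incl. the empty face). *)
Section Complex.
Variable n : nat.
Implicit Types (T : {set {set 'I_n}}) (v a b : 'I_n) (s e t : {set 'I_n}).

Definition is_face T s : bool := [exists t in T, s \subset t].

Definition edges T : {set {set 'I_n}} :=
  [set e : {set 'I_n} | (#|e| == 2)%N && is_face T e].

Definition link_rel T v : rel 'I_n := fun x y => [set v; x; y] \in T.
Definition skel_rel T : rel 'I_n := fun x y => [set x; y] \in edges T.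

(* incidence coefficient of edge e in the (vertex-order-induced) boundary of t *)
Definition bcoef t e : int :=
  (-1) ^+ #|[set x in e | [exists c in t :\: e, (x < c)%N]]|.

Definition closed_orientable_surface T (chi : int) : Prop :=
  [/\ (forall t, t \in T -> #|t| = 3),
      (forall v, exists2 t, t \in T & v \in t),
      (forall e, e \in edges T -> #|[set t in T | e \subset t]| = 2),
      (* vertex links are (connected) cycles *)
      (forall v a b, is_face T [set v; a] -> is_face T [set v; b] -> v != a -> v != b ->
         connect (link_rel T v) a b) &
    [/\
      (forall a b, connect (skel_rel T) a b),
      (exists eps : {set 'I_n} -> int,
         (forall t, t \in T -> eps t = 1 \/ eps t = -1) /\
         (forall e, e \in edges T ->
            \sum_(t in T | e \subset t) eps t * bcoef t e = 0)) &
      (n%:Z - #|edges T|%:Z + #|T|%:Z = chi)]].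

Definition genus_surface T (g : nat) : Prop :=
  closed_orientable_surface T (2%:Z - 2%:Z * g%:Z).

Variable R : realType.
Implicit Types p : 'I_n -> 'rV[R]_3.

Definition in_conv p s (x : 'rV[R]_3) : Prop :=
  exists lam : 'I_n -> R,
    [/\ (forall i, 0 <= lam i), (forall i, i \notin s -> lam i = 0),
        \sum_i lam i = 1 & x = \sum_i lam i *: p i].

Definition aff_indep p s : Prop :=
  forall lam : 'I_n -> R, (forall i, i \notin s -> lam i = 0) ->
    \sum_i lam i = 0 -> \sum_i lam i *: p i = 0 -> forall i, lam i = 0.

Definition geometric_realization T p : Prop :=
  [/\ injective p,
      (forall t, t \in T -> aff_indep p t) &
      (forall s1 s2, is_face T s1 -> is_face T s2 -> forall x,
         (in_conv p s1 x /\ in_conv p s2 x) <-> in_conv p (s1 :&: s2) x)].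

End Complex.

(* Main.v *)
(** Ten vertices and Euler characteristic -4 force 42 edges and 28 triangles, so
    exactly three pairs of vertices are non-adjacent; these form one of five
    graphs. An orientation turns the surface into a map [F] on ordered adjacent
    pairs with [F b (F a b) = a], where [(a, b, F a b)] is the positive triangle
    on the directed edge [ab], and every [F v] is one full cycle on the
    neighbours of [v]. Backtracking over the values of [F], for each of the five
    graphs, ends only in surfaces isomorphic to one of 20 listed ones. Each of
    these comes with integer coordinates, found by simulated annealing on the
    number of edge-triangle crossings. Any two triangles [t1], [t2] of a listed
    surface are separated by an affine function that vanishes on their common
    vertices, is positive on the rest of [t1] and negative on the rest of [t2].
    This gives the intersection condition, and also affine independence: take for
    [t2] the neighbours of [t1] along its edges. *)

From Stdlib Require Import ZArith.
Require Import Defs.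
From HB Require Import structures.
From mathcomp Require Import all_boot all_order all_algebra.
From mathcomp Require Import reals.
From mathcomp Require Import zify ssrZ.

Set Implicit Arguments.
Unset Strict Implicit.
Unset Printing Implicit Defensive.
Import Order.TTheory GRing.Theory Num.Theory.

(** * Separated triangles *)

Section SeparatedTriangles.
Local Open Scope ring_scope.
Variables (R : realType) (n : nat) (p : 'I_n -> 'rV[R]_3).
Implicit Types (T : {set {set 'I_n}}) (t s : {set 'I_n}) (lam mu : 'I_n -> R).

Definition separated T : Prop :=
  forall t1 t2, t1 \in T -> t2 \in T -> exists (u : 'cV[R]_3) (d : R),
    let h i := (p i *m u) 0 0 + d in
    [/\ {in t1 :&: t2, forall i, h i = 0}, {in t1 :\: t2, forall i, 0 < h i}
      & {in t2 :\: t1, forall i, h i < 0}].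

(** For triangles, [t'] lies across the edge of [t] opposite to [a]. *)
Definition neighbourly T : Prop :=
  forall t a, t \in T -> a \in t -> exists2 t', t' \in T & t :\: t' = [set a].

Lemma sum_aff lam (u : 'cV[R]_3) d :
  \sum_i lam i * ((p i *m u) 0 0 + d) =
  ((\sum_i lam i *: p i) *m u) 0 0 + (\sum_i lam i) * d.
Proof.
under eq_bigr do rewrite mulrDr.
rewrite big_split /= mulr_suml mulmx_suml summxE; congr (_ + _).
by apply: eq_bigr => i _; rewrite -scalemxAl [RHS]mxE.
Qed.

Lemma sum_set1 lam (h : 'I_n -> R) a :
  (forall i, i != a -> lam i * h i = 0) -> \sum_i lam i * h i = lam a * h a.
Proof. by move=> h0; rewrite (bigD1 a) //= big1 ?addr0. Qed.

(** The function separating [t] from its neighbour opposite to [i] vanishes at the other vertices of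
    [t]. Summed against an affine dependence on [t], it leaves [lam i * h i = 0] with [h i]
    positive. *)
Lemma separated_aff_indep T : separated T -> neighbourly T ->
  forall t, t \in T -> aff_indep p t.
Proof.
move=> sepT nbT t tT lam lam0 slam slamp i.
have [it|/lam0//] := boolP (i \in t).
have [t' t'T tt'] := nbT t i tT it.
have [u [d [h0 hpos _]]] := sepT _ _ tT t'T.
have := sum_aff lam u d; rewrite slam slamp mul0mx mxE mul0r addr0.
rewrite (sum_set1 (a := i)) => [/eqP|j ji]; last first.
  have [jt|/lam0 ->] := boolP (j \in t); last by rewrite mul0r.
  rewrite h0 ?mulr0 // inE jt /=; apply: contraNT ji => jt'.
  by rewrite -in_set1 -tt' inE jt' jt.
rewrite mulf_eq0 => /orP[/eqP//|/eqP h_i].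
by have := hpos i; rewrite h_i ltxx tt' inE eqxx => /(_ isT).
Qed.

(* A functional that separates two triangles vanishes at a common point of
   their hulls, so both sets of weights are carried by the common vertices. *)
Lemma separated_conv_cap T : separated T ->
    (forall t, t \in T -> aff_indep p t) ->
  forall s1 s2 x, is_face T s1 -> is_face T s2 ->
    in_conv p s1 x -> in_conv p s2 x -> in_conv p (s1 :&: s2) x.
Proof.
move=> sepT indT s1 s2 x /exists_inP[t1 t1T s1t] /exists_inP[t2 t2T s2t].
case=> lam [lam_ge0 lam0 lam1 xlam] [mu [mu_ge0 mu0 mu1 xmu]].
have [u [d]] := sepT _ _ t1T t2T; set h := fun i => (p i *m u) 0 0 + d.
case=> h0 hpos hneg.
have lamh i : 0 <= lam i * h i.
  have [is1|/lam0 ->] := boolP (i \in s1); last by rewrite mul0r.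
  have it1 := subsetP s1t _ is1; apply: mulr_ge0 => //.
  have [it2|it2] := boolP (i \in t2); first by rewrite h0 ?inE ?it1.
  by apply/ltW/hpos; rewrite inE it2.
have muh i : mu i * h i <= 0.
  have [is2|/mu0 ->] := boolP (i \in s2); last by rewrite mul0r.
  have it2 := subsetP s2t _ is2; apply: mulr_ge0_le0 => //.
  have [it1|it1] := boolP (i \in t1); first by rewrite h0 ?inE ?it1.
  by apply/ltW/hneg; rewrite inE it1.
have E : \sum_i lam i * h i = \sum_i mu i * h i.
  by rewrite !sum_aff -xlam -xmu lam1 mu1.
have lamh0 : \sum_i lam i * h i = 0.
  by apply/eqP; rewrite eq_le {1}E sumr_le0 ?sumr_ge0.
have lam_h0 i : lam i * h i = 0.
  move/eqP: lamh0; rewrite psumr_eq0 // => /allP /(_ i).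
  by rewrite mem_index_enum => /(_ isT)/eqP.
have mu_h0 i : mu i * h i = 0.
  have: \sum_i - (mu i * h i) = 0 by rewrite sumrN -E lamh0 oppr0.
  move/eqP; rewrite psumr_eq0 => [|j _]; last by rewrite oppr_ge0.
  by move=> /allP /(_ i); rewrite mem_index_enum oppr_eq0 => /(_ isT) /eqP.
have lam_t i : i \notin t1 -> lam i = 0.
  by move=> it; apply: lam0; apply: contraNN it; apply: subsetP s1t _.
have mu_t i : i \notin t1 -> mu i = 0.
  move=> it1; have [is2|/mu0//] := boolP (i \in s2).
  have := mu_h0 i; move/eqP; rewrite mulf_eq0 => /orP[/eqP//|/eqP hi].
  by have := hneg i; rewrite hi ltxx inE it1 (subsetP s2t) // => /(_ isT).
(* The difference of the two weights is an affine dependence carried by [t1]. *)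
have lam_mu i : lam i = mu i.
  apply/eqP; rewrite -subr_eq0; apply/eqP.
  apply: (indT t1 t1T (fun i => lam i - mu i)) => [j jt||].
  - by rewrite lam_t ?mu_t ?subr0.
  - by rewrite big_split /= sumrN lam1 mu1 subrr.
  - under eq_bigr do rewrite scalerBl.
    by rewrite big_split /= sumrN -xlam -xmu subrr.
exists lam; split=> // i; rewrite inE negb_and => /orP[/lam0//|/mu0].
by rewrite lam_mu.
Qed.

Lemma in_convW s s' x : s \subset s' -> in_conv p s x -> in_conv p s' x.
Proof.
move=> ss' [lam [lam_ge0 lam0 lam1 xlam]]; exists lam; split=> // i is'.
by apply: lam0; apply: contraNN is'; apply: subsetP.
Qed.

Lemma aff_indep_inj t : aff_indep p t -> {in t &, injective p}.
Proof.
move=> ind i j it jt pij; apply/eqP; apply/negPn/negP => ij.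
have sumE (M : lmodType R) (f : 'I_n -> M) k : \sum_l (l == k)%:R *: f l = f k.
  by rewrite (bigD1 k) //= eqxx scale1r big1 ?addr0 // => l /negPf->; rewrite scale0r.
(* If [p i = p j], the weights 1 at [i] and -1 at [j] form an affine dependence on [t]. *)
suff /(_ i)/eqP : forall k, (k == i)%:R - (k == j)%:R = 0 :> R.
  by rewrite eqxx (negPf ij) subr0 oner_eq0.
apply: ind => [k kt||].
- by have [ki kj] : k != i /\ k != j; [split; apply: contraNneq kt => ->|
    rewrite (negPf ki) (negPf kj) subrr].
- have one k : \sum_l (l == k)%:R = 1 :> R.
    by rewrite (bigD1 k) //= eqxx big1 ?addr0 // => l /negPf->.
  by rewrite big_split /= sumrN !one subrr.
- under eq_bigr do rewrite scalerBl.
  by rewrite big_split /= sumrN !sumE pij subrr.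
Qed.

Lemma separated_realization T : separated T -> neighbourly T ->
  (forall v, exists2 t, t \in T & v \in t) -> geometric_realization T p.
Proof.
move=> sepT nbT covT; have indT := separated_aff_indep sepT nbT.
split=> // [i j pij|s1 s2 f1 f2 x]; last first.
  split=> [[]|c12]; first exact: separated_conv_cap sepT indT _ _ _ f1 f2.
  by split; apply: in_convW c12; rewrite ?subsetIl ?subsetIr.
have [t1 t1T it1] := covT i; have [t2 t2T jt2] := covT j.
have [jt1|jt1] := boolP (j \in t1); first exact: aff_indep_inj (indT _ t1T) _ _ it1 jt1 pij.
have [it2|it2] := boolP (i \in t2); first exact: aff_indep_inj (indT _ t2T) _ _ it2 jt2 pij.
(* Neither triangle contains both vertices, so the function is positive at [p i] and negative at the
   same point [p j]. *)
have [u [d [_ hpos hneg]]] := sepT _ _ t1T t2T.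
have := hpos i; have := hneg j; rewrite !inE pij it1 it2 jt1 jt2 => /(_ isT) hj /(_ isT).
by rewrite ltNge (ltW hj).
Qed.

End SeparatedTriangles.

(** * Oriented surfaces *)

Lemma cards2_eq (X : finType) (S : {set X}) x y :
  #|S| = 2 -> x \in S -> y \in S -> x != y -> S = [set x; y].
Proof.
move=> S2 xS yS xy; apply/esym/eqP.
by rewrite eqEcard subUset !sub1set xS yS S2 cards2 xy.
Qed.

Section Orientation.
Local Open Scope ring_scope.
Variables (n : nat) (T : {set {set 'I_n}}) (eps : {set 'I_n} -> int).
Hypothesis T3 : forall t, t \in T -> #|t| = 3%N.
Hypothesis T2 :
  forall e, e \in edges T -> #|[set t in T | e \subset t]| = 2%N.
Hypothesis Tlink : forall v a b, is_face T [set v; a] -> is_face T [set v; b] ->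
  v != a -> v != b -> connect (link_rel T v) a b.
Hypothesis eps1 : forall t, t \in T -> eps t = 1 \/ eps t = -1.
Hypothesis eps0 : forall e, e \in edges T ->
  \sum_(t in T | e \subset t) eps t * bcoef t e = 0.
Implicit Types (a b c d v x y : 'I_n) (e t : {set 'I_n}).

Definition nbr a b := [set a; b] \in edges T.

Lemma nbrC a b : nbr a b = nbr b a.
Proof. by rewrite /nbr setUC. Qed.

Lemma nbrP a b : nbr a b = (a != b) && is_face T [set a; b].
Proof. by rewrite /nbr /edges inE cards2; case: (a != b). Qed.

Lemma nbr_neq a b : nbr a b -> a != b.
Proof. by rewrite nbrP => /andP[]. Qed.

Lemma triC a b c : [set a; b; c] = [set b; c; a].
Proof. by apply/setP => x; rewrite !inE -orbA orbC. Qed.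

Lemma tri_neq a b c : [set a; b; c] \in T -> [&& a != b, b != c & a != c].
Proof.
move=> /T3; apply: contra_eqT; rewrite !negb_and !negbK => /or3P[] /eqP->.
- by rewrite setUid cards2; case: (b != c).
- by rewrite -setUA setUid cards2; case: (a != c).
- by rewrite -triC setUid cards2; case: (c != b).
Qed.

Lemma tri_nbr a b c : [set a; b; c] \in T -> nbr a b.
Proof.
move=> tT; have /and3P[ab _ _] := tri_neq tT; rewrite nbrP ab.
by apply/exists_inP; exists [set a; b; c]; rewrite ?subsetUl.
Qed.

Lemma nbr_tri a b t : a != b -> t \in T -> [set a; b] \subset t ->
  exists c, t = [set a; b; c].
Proof.
move=> ab tT st; have : #|t :\: [set a; b]| == 1%N.
  by rewrite cardsD (setIidPr st) T3 // cards2 ab.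
move=> /cards1P[c tc]; exists c.
by rewrite -tc -{1}(setID t [set a; b]) (setIidPr st).
Qed.

(** Since [c] is the only vertex off the edge, the exponent counts the end points that precede
    [c]. *)
Lemma bcoefE a b c : [set a; b; c] \in T ->
  bcoef [set a; b; c] [set a; b] = (-1) ^+ ((a < c)%N + (b < c)%N).
Proof.
move=> /tri_neq /and3P[ab bc ac]; rewrite /bcoef; congr (_ ^+ _).
have -> : [set a; b; c] :\: [set a; b] = [set c].
  apply/setP => x; rewrite !inE; have [->|xa] := eqVneq x a; first by rewrite (negPf ac).
  by have [->|xb] := eqVneq x b; first by rewrite (negPf bc).
rewrite -sum1_card.
under eq_bigl => x.
  rewrite inE; have -> : [exists y in [set c], (x < y)%N] = (x < c)%N.
    apply/exists_inP/idP => [[y /set1P->]//|xc]; exists c => //; exact: set11.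
  over.
by rewrite big_mkcondr /= big_setU1 ?inE // big_set1; do 2!case: ltnP.
Qed.

Lemma ord_ltnN a b : a != b -> (b < a)%N = ~~ (a < b)%N.
Proof. by rewrite -(inj_eq val_inj) /=; case: ltngtP. Qed.

(* The factor [(-1) ^ (b < a)] turns the coefficient of the edge into the sign of
   the ordering [(a, b, c)], which is why [pos] is invariant under rotation. *)
Definition pos a b c := ([set a; b; c] \in T) &&
  (eps [set a; b; c] * bcoef [set a; b; c] [set a; b] == (-1) ^+ (b < a)%N).

Lemma pos_tri a b c : pos a b c -> [set a; b; c] \in T.
Proof. by case/andP. Qed.

Lemma pos_cyc a b c : pos a b c -> pos b c a.
Proof.
move=> /andP[tT]; have tT' := tT; rewrite triC in tT'.
rewrite /pos tT' !bcoefE // -(triC a b c).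
have /and3P[ab bc ac] := tri_neq tT.
rewrite (ord_ltnN ac) (ord_ltnN bc).
by case: (eps1 tT) => ->; do 3!case: ltnP => _.
Qed.

(** Exchanging [a] and [b] keeps the triangle and the edge, and changes only the sign they are
    compared with. *)
Lemma pos_or a b c : [set a; b; c] \in T -> pos b a c = ~~ pos a b c.
Proof.
move=> tT; have tT' : [set b; a; c] \in T by rewrite (setUC [set b]).
rewrite /pos tT tT' !bcoefE // (setUC [set b]).
have /and3P[ab _ _] := tri_neq tT.
rewrite (ord_ltnN ab).
by case: (eps1 tT) => ->; do 3!case: ltnP => _.
Qed.

Lemma edge_sum a b t t' : nbr a b -> t \in T -> t' \in T -> t != t' ->
    [set a; b] \subset t -> [set a; b] \subset t' ->
  eps t * bcoef t [set a; b] + eps t' * bcoef t' [set a; b] = 0.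
Proof.
move=> ab tT t'T tt' st st'; rewrite -[RHS](eps0 ab).
rewrite (eq_bigl (mem [set t in T | [set a; b] \subset t])) => [|x]; last by rewrite !inE.
rewrite (cards2_eq (T2 ab) (x := t) (y := t')) ?inE ?tT ?t'T //.
by rewrite big_setU1 ?inE // big_set1.
Qed.

(** Two positive triangles on one directed edge would contribute equal signs to a boundary sum that
    is zero. *)
Lemma pos_uniq a b c d : pos a b c -> pos a b d -> c = d.
Proof.
move=> pc pd; apply/eqP/negPn/negP => cd.
have [tc td] := (pos_tri pc, pos_tri pd); have ab := tri_nbr tc.
have [/and3P[_ bc ac] /and3P[_ bd ad]] := (tri_neq tc, tri_neq td).
have tcd : [set a; b; c] != [set a; b; d].
  have : c \in [set a; b; c] by rewrite !inE eqxx orbT.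
  by apply: contraTneq => ->; rewrite !inE !negb_or !(eq_sym c) ac bc eq_sym.
have := edge_sum ab tc td tcd (subsetUl _ _) (subsetUl _ _).
by case/andP: pc => _ /eqP->; case/andP: pd => _ /eqP->; case: (b < a)%N.
Qed.

(** The two triangles on the edge contribute opposite signs, so one of them has the sign that [pos]
    asks for. *)
Lemma pos_exists a b : nbr a b -> exists c, pos a b c.
Proof.
move=> ab; have /eqP/cards2P[t [t' [tt' tS]]] := T2 ab.
have : t \in [set t; t'] by rewrite !inE eqxx.
have : t' \in [set t; t'] by rewrite !inE eqxx orbT.
rewrite -tS !inE => /andP[t'T st'] /andP[tT st].
have [c tE] := nbr_tri (nbr_neq ab) tT st.
have [d t'E] := nbr_tri (nbr_neq ab) t'T st'.
have := edge_sum ab tT t'T tt' st st'; rewrite tE t'E in tT t'T *.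
case pc : (pos a b c) => [|]; first by exists c.
case pd : (pos a b d) => [|]; first by exists d.
move: pc pd; rewrite /pos tT t'T /= !bcoefE //.
by case: (eps1 tT) => ->; case: (eps1 t'T) => ->; do 5!case: ltnP => _.
Qed.

(** The default [a] is never reached when [a] and [b] are adjacent. *)
Definition nxt a b := odflt a [pick c | pos a b c].

Lemma pos_nxt a b : nbr a b -> pos a b (nxt a b).
Proof.
move=> /pos_exists[c pc]; rewrite /nxt; case: pickP => //= /(_ c).
by rewrite pc.
Qed.

Lemma nxt_pos a b c : pos a b c -> nxt a b = c.
Proof. by move=> pc; apply: pos_uniq (pos_nxt (tri_nbr (pos_tri pc))) pc. Qed.

Lemma nxt_nbr a b : nbr a b -> nbr b (nxt a b).
Proof. by move=> /pos_nxt/pos_cyc/pos_tri/tri_nbr. Qed.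

Lemma nxt_nbr2 a b : nbr a b -> nbr a (nxt a b).
Proof. by move=> /pos_nxt/pos_cyc/pos_cyc/pos_tri/tri_nbr; rewrite nbrC. Qed.

Lemma nxtK a b : nbr a b -> nxt b (nxt a b) = a.
Proof. by move=> /pos_nxt/pos_cyc/nxt_pos. Qed.

Lemma nxtK2 a b : nbr a b -> nxt (nxt a b) a = b.
Proof. by move=> /pos_nxt/pos_cyc/pos_cyc/nxt_pos. Qed.

Lemma tri_vtx t a : t \in T -> a \in t -> exists b c, t = [set a; b; c].
Proof.
move=> tT at_; have /eqP/cards2P[b [c [bc tE]]] : #|t :\ a| = 2%N.
  by have := cardsD1 a t; rewrite at_ (T3 tT) => -[].
by exists b, c; rewrite -setUA -tE setD1K.
Qed.

(** One of the two orientations of a triangle is positive, so [nxt] determines [T]. *)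
Lemma tri_nxt t : t \in T -> exists a b, nbr a b /\ t = [set a; b; nxt a b].
Proof.
move=> tT; have : (0 < #|t|)%N by rewrite T3.
rewrite card_gt0 => /set0Pn[a at_]; have [b [c tE]] := tri_vtx tT at_.
rewrite tE in tT *; have := pos_or tT; case pc : (pos a b c) => pc'.
  by exists a, b; rewrite (nxt_pos pc) (tri_nbr tT).
by exists b, a; rewrite (nxt_pos pc') nbrC (tri_nbr tT) (setUC [set b]).
Qed.

Lemma link_pos v y z : link_rel T v y z -> nxt v y = z \/ nxt v z = y.
Proof.
rewrite /link_rel => tT; have := pos_or tT.
case pc : (pos v y z) => pc'; first by left; apply: nxt_pos.
by right; apply/nxt_pos/pos_cyc.
Qed.

(** By [nxtK2], [nxt v] is injective on the neighbours of [v], so a closed orbit contains the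
    predecessor as well as the successor of each of its points. As the link is connected, the orbit
    contains every neighbour of [v]. *)
Lemma nxt_orbit v x k : nbr v x -> (0 < k)%N -> iter k (nxt v) x = x ->
  (#|[set y | nbr v y]| <= k)%N.
Proof.
move=> vx k_gt0 kx; pose O := [set iter i (nxt v) x | i : 'I_k].
suff sO : [set y | nbr v y] \subset O.
  apply: leq_trans (subset_leq_card sO) _.
  by apply: leq_trans (leq_imset_card _ _) _; rewrite card_ord.
have iterO i : (i <= k)%N -> iter i (nxt v) x \in O.
  rewrite leq_eqVlt => /orP[/eqP->|ik]; last by apply/imsetP; exists (Ordinal ik).
  by rewrite kx; apply/imsetP; exists (Ordinal k_gt0).
have nbrO i : nbr v (iter i (nxt v) x) by elim: i => //= i; apply: nxt_nbr2.
have linkO y z : y \in O -> link_rel T v y z -> z \in O.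
  move=> /imsetP[[i ik] _ -> /=] yz; have vzn : nbr v z.
    by move: yz; rewrite /link_rel setUAC => /tri_nbr.
  have [<-|vz] := link_pos yz; first by rewrite -iterS iterO.
  (* The predecessor has index [i - 1], or [k - 1] when [i] is 0. *)
  have [j jk ij] : exists2 j, (j < k)%N & iter i (nxt v) x = nxt v (iter j (nxt v) x).
    case: i ik {yz vz vzn} => [_|i ik]; last by exists i => //; apply: ltnW.
    by exists k.-1; rewrite ?prednK // -iterS prednK.
  rewrite -(nxtK2 vzn) vz ij nxtK2; last exact: nbrO.
  exact/iterO/ltnW.
apply/subsetP => z; rewrite inE => vz.
have /connectP[q + ->] : connect (link_rel T v) x z.
  by move: vx vz; rewrite !nbrP => /andP[? ?] /andP[? ?]; apply: Tlink.
have {kx iterO nbrO} : x \in O by apply: (iterO 0).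
move: linkO; move: O => O linkO; elim: q x {vx} => //= y q IHq x xO /andP[xy].
by apply: IHq (linkO _ _ xO xy).
Qed.

(** The second triangle on the edge opposite to [a] misses [a]: otherwise it would contain [t], and
    both have three vertices. *)
Lemma surface_neighbourly : neighbourly T.
Proof.
move=> t a tT at_; have [b [c tE]] := tri_vtx tT at_.
have bc : nbr b c by rewrite (@tri_nbr b c a) // -triC -tE.
have ab : a \notin [set b; c].
  have := tri_neq (a := a) (b := b) (c := c); rewrite -tE => /(_ tT) /and3P[ab _ ac].
  by rewrite !inE negb_or ab.
have st : [set b; c] \subset t by rewrite tE -setUA subsetUr.
have := T2 bc; rewrite (cardsD1 t) inE tT st => -[/eqP].
move=> /cards1P[t' /setP/(_ t')]; rewrite !inE eqxx => /and3P[t't t'T st'].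
have at' : a \notin t'.
  apply: contra t't => at'; rewrite eq_sym eqEcard !T3 // tE -setUA subUset.
  by rewrite sub1set at' st'.
exists t' => //; apply/setP => x; rewrite tE !inE.
have [->|xa] := eqVneq x a; first by rewrite at'.
apply/negP => /andP[xt' xbc]; case/negP: xt'.
by apply: subsetP st' _ _; rewrite !inE.
Qed.

(** Double counting of incident pairs of an edge and a triangle. *)
Lemma edges_faces : (#|edges T| * 2 = #|T| * 3)%N.
Proof.
transitivity (\sum_(e in edges T) \sum_(t in T | e \subset t) 1)%N.
  rewrite -sum_nat_const; apply: eq_bigr => e eE; rewrite -(T2 eE) -sum1_card.
  by apply: eq_bigl => t; rewrite inE.
rewrite (exchange_big_dep (mem T)) /=; last by move=> ? ? _ /andP[].
rewrite -sum_nat_const; apply: eq_bigr => t tT.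
transitivity #|[set e : {set 'I_n} | e \subset t & #|e| == 2%N]|; last first.
  by rewrite cards_draws T3.
rewrite sum1dep_card; apply: eq_card => e; rewrite !inE tT /=.
have [et|] := boolP (e \subset t); last by rewrite andbF.
by rewrite andbT; case: eqP => //= _; apply/exists_inP; exists t.
Qed.

End Orientation.

(** * Backtracking search *)

(* Ten constructors and ten-field records make table access a bounded number of
   case analyses, so that the kernel can evaluate the search. *)
Inductive lab := L0 | L1 | L2 | L3 | L4 | L5 | L6 | L7 | L8 | L9.

Definition labs := [:: L0; L1; L2; L3; L4; L5; L6; L7; L8; L9].

Definition eql a b := match a, b with
  | L0, L0 | L1, L1 | L2, L2 | L3, L3 | L4, L4
  | L5, L5 | L6, L6 | L7, L7 | L8, L8 | L9, L9 => true
  | _, _ => false end.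

Lemma eqlP : Equality.axiom eql.
Proof. by case; case; constructor. Qed.

HB.instance Definition _ := hasDecEq.Build lab eqlP.

Inductive vec (A : Type) := Vec of A & A & A & A & A & A & A & A & A & A.

Definition vget A (v : vec A) a :=
  let: Vec x0 x1 x2 x3 x4 x5 x6 x7 x8 x9 := v in
  match a with
  | L0 => x0 | L1 => x1 | L2 => x2 | L3 => x3 | L4 => x4
  | L5 => x5 | L6 => x6 | L7 => x7 | L8 => x8 | L9 => x9 end.

Definition vset A (v : vec A) a x :=
  let: Vec x0 x1 x2 x3 x4 x5 x6 x7 x8 x9 := v in
  match a with
  | L0 => Vec x x1 x2 x3 x4 x5 x6 x7 x8 x9
  | L1 => Vec x0 x x2 x3 x4 x5 x6 x7 x8 x9
  | L2 => Vec x0 x1 x x3 x4 x5 x6 x7 x8 x9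
  | L3 => Vec x0 x1 x2 x x4 x5 x6 x7 x8 x9
  | L4 => Vec x0 x1 x2 x3 x x5 x6 x7 x8 x9
  | L5 => Vec x0 x1 x2 x3 x4 x x6 x7 x8 x9
  | L6 => Vec x0 x1 x2 x3 x4 x5 x x7 x8 x9
  | L7 => Vec x0 x1 x2 x3 x4 x5 x6 x x8 x9
  | L8 => Vec x0 x1 x2 x3 x4 x5 x6 x7 x x9
  | L9 => Vec x0 x1 x2 x3 x4 x5 x6 x7 x8 x end.

Definition vmk A (f : lab -> A) :=
  Vec (f L0) (f L1) (f L2) (f L3) (f L4) (f L5) (f L6) (f L7) (f L8) (f L9).

Lemma vget_mk A (f : lab -> A) a : vget (vmk f) a = f a.
Proof. by case: a. Qed.

Lemma vget_set A (v : vec A) a x b :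
  vget (vset v a x) b = if a == b then x else vget v b.
Proof. by case: v a b => ? ? ? ? ? ? ? ? ? ?; case; case. Qed.

(* Entry [(a, b)] of a partial surface: undetermined, not an edge, or the third
   vertex of the positive triangle on the directed edge [ab]. *)
Inductive cell := Un | No | Is of lab.
Definition mat := vec (vec cell).
Definition mget (M : mat) a b := vget (vget M a) b.
Definition mset (M : mat) a b x : mat := vset M a (vset (vget M a) b x).
(** All three directed edges of a triangle are filled at once, in keeping with [F b (F a b) = a]. *)
Definition put M a b c :=
  mset (mset (mset M a b (Is c)) b c (Is a)) c a (Is b).

Definition all_lab (P : lab -> bool) :=
  P L0 && (P L1 && (P L2 && (P L3 && (P L4 &&
  (P L5 && (P L6 && (P L7 && (P L8 && P L9)))))))).

(* [F v x = z] is impossible if the known values of [F v] lead from [z] back to [x]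
   in at most [deg v - 2] steps: the cycle around [v] would be too short. *)
Fixpoint closes (M : mat) v x z k :=
  if k is k'.+1 then
    if mget M v z is Is z' then eql z' x || closes M v x z' k' else false
  else false.

Definition fits x d := match x with Un => true | No => false | Is y => eql y d end.

(** The entry [(a, b)] is undetermined whenever [search] branches on it, so only the other two
    directed edges are compared. *)
Definition ok (dg : vec nat) M a b c :=
  fits (mget M b c) a && (fits (mget M c a) b &&
  ~~ (closes M a b c (vget dg a) || (closes M b c a (vget dg b)
      || closes M c a b (vget dg c)))).

Definition swapl c d a := if eql a c then d else if eql a d then c else a.

Definition eqcell x y := match x, y with
  | Un, Un | No, No => true | Is a, Is b => eql a b | _, _ => false end.

Definition swapcell c d x := if x is Is a then Is (swapl c d a) else x.

Definition swap_inv (dg : vec nat) M c d :=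
  (vget dg c == vget dg d) &&
  all_lab (fun a => all_lab (fun b =>
    eqcell (mget M (swapl c d a) (swapl c d b)) (swapcell c d (mget M a b)))).

Definition is_open x := if x is Un then 1 else 0.
Definition count_open (r : vec cell) :=
  let: Vec x0 x1 x2 x3 x4 x5 x6 x7 x8 x9 := r in
  is_open x0 + (is_open x1 + (is_open x2 + (is_open x3 + (is_open x4 +
  (is_open x5 + (is_open x6 + (is_open x7 + (is_open x8 + is_open x9)))))))).

(* The choice of the next edge affects the size of the search only. *)
Fixpoint pickrow (M : mat) (s : seq lab) (best : option (nat * lab)) :=
  if s is a :: s' then
    let k := count_open (vget M a) in
    pickrow M s' (match k, best with
      | 0, _ => best
      | _, None => Some (k, a)
      | _, Some (k', _) => if k < k' then Some (k, a) else best end)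
  else best.

(** Directed edges whose reverse is already settled come first, so that the new triangle is glued to
    a placed one. *)
Fixpoint pickcol (M : mat) a (s : seq lab) best :=
  if s is b :: s' then
    if mget M a b is Un then
      if mget M b a is Un then pickcol M a s' (if best is None then Some b else best)
      else Some b
    else pickcol M a s' best
  else best.

Definition pick_open M :=
  if pickrow M labs None is Some (_, a) then
    if pickcol M a labs None is Some b then Some (a, b) else None
  else None.

Section Search.
Variables (dg : vec nat) (leaf : mat -> bool).

Section Branch.
Variables (rec : mat -> bool) (M : mat) (sym : bool) (a b : lab).
(* A value [c] is skipped if a transposition [(d c)] with [d] already treated is a
   symmetry of the partial surface fixing [a] and [b]. *)
Fixpoint branch cs done :=
  if cs is c :: cs' then
    if ok dg M a b c then
      if sym && has (fun d => ~~ (eql a c || eql b c || eql a d || eql b d)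
                              && swap_inv dg M d c) done
      then branch cs' done
      else rec (put M a b c) && branch cs' (c :: done)
    else branch cs' done
  else true.
End Branch.

(** Running out of fuel gives [false], so a successful run is exhaustive. The counter [sym] is the
    number of levels left at which symmetries are tried. *)
Fixpoint search n sym M :=
  if n is n'.+1 then
    if pick_open M is Some (a, b) then
      if mget M a b is Un then
        branch (search n' sym.-1) M (0 < sym) a b labs [::]
      else false
    else leaf M
  else false.

End Search.

Definition init (ne : seq (lab * lab)) : mat :=
  vmk (fun a => vmk (fun b =>
    if [|| eql a b, (a, b) \in ne | (b, a) \in ne] then No else Un)).
(* Two less than the degree, the number of steps allowed in [closes]. *)
Definition degs (M : mat) : vec nat := vmk (fun a => (count_open (vget M a)).-2).

(** * Tables of known surfaces and the isomorphism test *)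

Definition empty : mat := vmk (fun _ => vmk (fun _ => No)).
Definition tri := (lab * lab * lab)%type.
Definition seq_of_tri (t : tri) : seq lab := let: (a, b, c) := t in [:: a; b; c].
(* [flip] gives the mirror image. *)
Fixpoint mat_of (flip : bool) (K : seq tri) :=
  if K is (a, b, c) :: K' then
    if flip then put (mat_of flip K') b a c else put (mat_of flip K') a b c
  else empty.

(* [L9] is adjacent to every other vertex, so an isomorphism is determined by the
   image of the directed edge from [L9] to [L0]. *)
Fixpoint follow (M G : mat) r x z w k (s : vec lab) :=
  if k is k'.+1 then
    match mget M r z, mget G x w with
    | Is z', Is w' => follow M G r x z' w' k' (vset s z w)
    | _, _ => None end
  else Some s.

Definition is_no x := if x is No then true else false.
(** An undetermined entry is rejected, so [pick_open] may be trusted blindly: an incomplete table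
    never passes as a leaf. *)
Definition embeds (M G : mat) (s : vec lab) :=
  all_lab (fun a => all_lab (fun b =>
    match mget M a b with
    | Is c => eqcell (mget G (vget s a) (vget s b)) (Is (vget s c))
    | No => is_no (mget G (vget s a) (vget s b))
    | Un => false end))
  && all_lab (fun a => all_lab (fun b => eql (vget s a) (vget s b) ==> eql a b)).

Definition full (G : mat) x := all_lab (fun b => eql b x || ~~ is_no (mget G x b)).

(** The constant initial vector already sends [L9] to [x], and nine steps go once around the
    neighbours of [L9]. *)
Definition iso_to M G :=
  has (fun x => full G x && has (fun y => ~~ eql x y &&
    if follow M G L9 x L0 y 9 (vmk (fun=> x)) is Some s then embeds M G s else false) labs) labs.

Definition is_known (Gs : seq mat) M := has (iso_to M) Gs.

(* 40 exceeds the depth of the search tree, as each level adds one of 28 triangles;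
   9 is the number of levels at which symmetries are looked for. *)
Definition check_pattern ne (Ks : seq (seq tri)) :=
  let M := init ne in
  let Gs := map (mat_of false) Ks ++ map (mat_of true) Ks in
  all (fun v => 1 < count_open (vget M v)) labs && search (degs M) (is_known Gs) 40 9 M.

Lemma eqcellP x y : eqcell x y -> x = y.
Proof. by case: x y => [||a] [||b] //= /eqlP->. Qed.

Lemma all_labP (P : pred lab) : reflect (forall a, P a) (all_lab P).
Proof.
apply: (iffP idP) => [|Pall]; last by rewrite /all_lab !Pall.
by rewrite /all_lab; do 9!case/andP=> ?; move=> ?; case.
Qed.

Lemma mem_labs a : a \in labs.
Proof. by case: a. Qed.

Lemma mget_set M a b x c d :
  mget (mset M a b x) c d = if (a == c) && (b == d) then x else mget M c d.
Proof. by rewrite /mget /mset vget_set; case: eqVneq => //= <-; rewrite vget_set. Qed.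

Lemma mget_put M a b c x y : mget (put M a b c) x y =
  if (c == x) && (a == y) then Is b else if (b == x) && (c == y) then Is a
  else if (a == x) && (b == y) then Is c else mget M x y.
Proof. by rewrite /put !mget_set. Qed.

(** Only the vertex set of the triangle is retained, which a mirror image does not change. *)
Lemma mget_mat_of flip K a b c : mget (mat_of flip K) a b = Is c ->
  exists2 t, t \in K & [:: a; b; c] =i seq_of_tri t.
Proof.
elim: K => [|[[x y] z] K IHK] /=; first by rewrite /mget !vget_mk.
have tail : (exists2 t, t \in K & [:: a; b; c] =i seq_of_tri t) ->
    exists2 t, t \in (x, y, z) :: K & [:: a; b; c] =i seq_of_tri t.
  by case=> t tK abct; exists t; rewrite ?inE ?tK ?orbT.
by case: flip IHK => IHK; rewrite mget_put;
  do 3![case: andP => [[/eqP-> /eqP->] [<-]|_];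
    first by eexists; [exact: mem_head | move=> i; rewrite !inE; do 3!case: (i == _)]];
  move=> /IHK.
Qed.

Lemma swaplK c d : involutive (swapl c d).
Proof. by move=> a; rewrite /swapl; case: c; case: d; case: a. Qed.

(** * Correctness of the search *)

Section Soundness.
Variables (N : rel 'I_10) (F : 'I_10 -> 'I_10 -> 'I_10).
Hypothesis F_nbr : forall a b, N a b -> N b (F a b).
Hypothesis FK : forall a b, N a b -> F b (F a b) = a.
Hypothesis F_orbit : forall v x k, N v x -> 0 < k -> iter k (F v) x = x ->
  #|[set y | N v y]| <= k.
Implicit Types (e : lab -> 'I_10) (M : mat).

Variable dg : vec nat.

(** An entry [Un] still stands for an adjacent pair, since the non-edges are fixed from the start.
    The [+ 2] undoes the subtraction in [degs]. *)
Definition compat e M := [/\ injective e,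
  forall a b, match mget M a b return Prop with
    | Un => N (e a) (e b)
    | No => ~~ N (e a) (e b)
    | Is c => N (e a) (e b) /\ F (e a) (e b) = e c end
  & forall v, vget dg v + 2 <= #|[set y | N (e v) y]|].

Lemma lab_surj e x : injective e -> x \in map e labs.
Proof.
move=> e_inj; have ue : uniq (map e labs) by rewrite map_inj_uniq.
have /card_uniqP := ue; rewrite size_map => ce.
have /subset_cardP eq_e : #|map e labs| = #|'I_10| by rewrite ce card_ord.
by rewrite (eq_e _) //; apply/subsetP.
Qed.

Lemma closes_iter e M v x z k : compat e M -> closes M v x z k ->
  exists2 j, 0 < j <= k & iter j (F (e v)) (e z) = e x.
Proof.
case=> _ eM _; elim: k z => //= k IHk z; have := eM v z.
case: (mget M v z) => // z' [_ Fz] /orP[/eqlP <-|/IHk[j /andP[j0 jk] jx]].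
  by exists 1.
by exists j.+1; rewrite ?ltnS ?jk // iterSr Fz.
Qed.

(** Returning to [x] within [vget dg v] steps from [z] would give an orbit of length below the
    degree, against [F_orbit]. *)
Lemma closes_false e M v x z : compat e M -> N (e v) (e x) ->
  F (e v) (e x) = e z -> closes M v x z (vget dg v) = false.
Proof.
move=> eM vx vz; apply/negP => /(closes_iter eM)[j /andP[j0 jd] jx].
have /(F_orbit vx (ltn0Sn _)) : iter j.+1 (F (e v)) (e x) = e x by rewrite iterSr vz.
case: eM => _ _ /(_ v) dv dj; have := leq_trans dv dj.
by rewrite addn2 ltnS => /leq_trans/(_ jd); rewrite ltnn.
Qed.

Lemma compat_ok e M a b c : compat e M -> N (e a) (e b) ->
  F (e a) (e b) = e c -> ok dg M a b c.
Proof.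
move=> eM ab abc; have := F_nbr ab; have := FK ab; rewrite abc => bca bc.
have := F_nbr bc; have := FK bc; rewrite bca => cab ca.
rewrite /ok !(closes_false eM) //= andbT.
case: eM => e_inj eM _; apply/andP; split.
  have := eM b c; case: (mget M b c) => //= [|d]; first by rewrite bc.
  by rewrite bca => -[_ /e_inj->]; apply/eqlP.
have := eM c a; case: (mget M c a) => //= [|d]; first by rewrite ca.
by rewrite cab => -[_ /e_inj->]; apply/eqlP.
Qed.

Lemma compat_put e M a b c : compat e M -> N (e a) (e b) ->
  F (e a) (e b) = e c -> compat e (put M a b c).
Proof.
move=> [e_inj eM edg] ab abc; split=> // x y; rewrite mget_put.
have := F_nbr ab; have := FK ab; rewrite abc => bca bc.
have := F_nbr bc; have := FK bc; rewrite bca => cab ca.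
by do 3![case: andP => [[/eqP<- /eqP<-] //|_]]; apply: eM.
Qed.

(** This justifies skipping a value: a symmetry of the table turns one labelling of the surface into
    another. *)
Lemma compat_swap e M c d : swap_inv dg M c d -> compat e M ->
  compat (e \o swapl c d) M.
Proof.
move=> /andP[/eqP dgcd /all_labP swM] [e_inj eM edg]; split=> [||v].
- exact: inj_comp (inv_inj (swaplK c d)).
- move=> a b /=; have /all_labP/(_ b)/eqcellP := swM a.
  have := eM (swapl c d a) (swapl c d b).
  by case: (mget M a b) => [||x] /= + E; rewrite E.
suff <- : vget dg (swapl c d v) = vget dg v by apply: edg.
rewrite /swapl; have [->|vc] := eqlP v c; first by rewrite -dgcd.
by have [->|] := eqlP v d.
Qed.

Variable Good : Prop.
Variable leaf : mat -> bool.
Hypothesis leafP : forall e M, leaf M -> compat e M -> Good.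

(** The invariant on [done] ranges over all labellings, so that it can be applied after a
    transposition of labels. *)
Lemma branchP (rec : mat -> bool) M sym a b :
    (forall e M', rec M' -> compat e M' -> Good) ->
  forall cs done, branch dg rec M sym a b cs done ->
    (forall d e, d \in done -> compat e M -> N (e a) (e b) ->
       F (e a) (e b) = e d -> Good) ->
  forall c e, c \in cs -> compat e M -> N (e a) (e b) ->
    F (e a) (e b) = e c -> Good.
Proof.
move=> recP; elim=> // c cs IHcs done /= + doneP c' e.
have [okc|nok] := boolP (ok dg M a b c); last first.
  move=> br; rewrite inE => /predU1P[-> eM ab abc|]; last exact: IHcs br doneP _ _.
  by rewrite (compat_ok eM ab abc) in nok.
case: ifP => [/andP[_ /hasP[d dd /andP[/norP[/norP[/norP[ac bc] ad] bd] sw]]]|_].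
  move=> br; rewrite inE => /predU1P[-> eM ab abc|]; last exact: IHcs br doneP _ _.
  (* In the transposed labelling [a] and [b] keep their vertices, while the vertex [e c] bears the
     label [d], already treated. *)
  have Ea : (e \o swapl d c) a = e a.
    by rewrite /= /swapl (negPf ad) (negPf ac).
  have Eb : (e \o swapl d c) b = e b.
    by rewrite /= /swapl (negPf bd) (negPf bc).
  apply: (doneP d _ dd (compat_swap sw eM)); rewrite Ea Eb //= abc.
  by rewrite /swapl; case: eqlP.
move=> /andP[rc br]; have cP : forall e, compat e M -> N (e a) (e b) -> F (e a) (e b) = e c -> Good.
  by move=> f fM ab abc; apply: recP rc (compat_put fM ab abc).
rewrite inE => /predU1P[->|c'cs]; first exact: cP.
apply: IHcs br _ _ _ c'cs => d f; rewrite inE => /predU1P[->|]; first exact: cP.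
exact: doneP.
Qed.

#[local] Arguments branch : simpl never.

Lemma searchP n sym e M : search dg leaf n sym M -> compat e M -> Good.
Proof.
elim: n sym e M => // n IHn sym e M /=.
case: (pick_open M) => [[a b]|]; last exact: leafP.
case Mab: (mget M a b) => // br eM; have [e_inj /(_ a b)] := eM; rewrite Mab => ab _.
have /mapP[c cl abc] := lab_surj (F (e a) (e b)) e_inj.
by apply: (branchP _ br _ cl eM ab abc) => // f M'; apply: IHn.
Qed.

End Soundness.

(** * Graphs with three edges *)

Lemma eq_set2 (X : finType) (x y z w : X) : ([set x; y] == [set z; w]) =
  ((x == z) && (y == w)) || ((x == w) && (y == z)).
Proof.
apply/eqP/orP => [E|[] /andP[/eqP-> /eqP->] //]; last by rewrite setUC.
have wE : w \in [set x; y] by rewrite E set22.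
have zE : z \in [set x; y] by rewrite E set21.
have yE : y \in [set z; w] by rewrite -E set22.
have : x \in [set z; w] by rewrite -E set21.
move: wE zE yE; rewrite {E} !inE => wE zE yE /orP[]/eqP xE; subst x.
  case/orP: yE => /eqP yE; subst y; last by left; rewrite !eqxx.
  by left; rewrite eqxx eq_sym; case/orP: wE.
case/orP: yE => /eqP yE; subst y; first by right; rewrite !eqxx.
by right; rewrite eqxx eq_sym; case/orP: zE.
Qed.

(** Appending the remaining vertices to [s] gives an enumeration of all ten. *)
Lemma labelling (s : seq 'I_10) x0 : uniq s -> exists2 e : lab -> 'I_10,
  injective e & forall a, index a labs < size s -> e a = nth x0 s (index a labs).
Proof.
move=> us; pose r := s ++ [seq x <- enum 'I_10 | x \notin s].
have ur : uniq r.
  rewrite cat_uniq us filter_uniq ?enum_uniq // andbT; apply/hasPn => x.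
  by rewrite mem_filter => /andP[].
have sr : size r = 10.
  rewrite -(card_uniqP ur) -[RHS]card_ord; apply: eq_card => x.
  by rewrite mem_cat mem_filter mem_enum andbT orbN.
exists (fun a => nth x0 r (index a labs)) => [a b /eqP|a ia]; last by rewrite nth_cat ia.
have il c : index c labs < size r by rewrite sr; case: c.
by rewrite nth_uniq // => /eqP; case: a; case: b.
Qed.

Definition nonedges (D : {set {set 'I_10}}) (ne : seq (lab * lab)) := exists2 e : lab -> 'I_10,
  injective e & forall a b, ([set e a; e b] \in D) = ((a, b) \in ne) || ((b, a) \in ne).

Lemma nonedges_label (D : {set {set 'I_10}}) s x0 ne : uniq s ->
    all (fun p => (index p.1 labs < size s) && (index p.2 labs < size s)) ne ->
    D =i [seq [set nth x0 s (index p.1 labs); nth x0 s (index p.2 labs)] | p <- ne] ->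
  nonedges D ne.
Proof.
move=> us sne DE; have [e e_inj es] := labelling x0 us; exists e => // a b.
rewrite {}DE; elim: ne sne => [|[c d] ne IHne] //= /andP[/andP[ic id] {}/IHne IHne].
rewrite !inE {}IHne -!es // eq_set2 !(inj_eq e_inj) !xpair_eqE.
by do 4!case: (_ == _); do 2!case: (_ \in _).
Qed.

Definition missing_triangle := [:: (L0, L1); (L1, L2); (L0, L2)].
Definition missing_star := [:: (L0, L1); (L1, L2); (L1, L3)].
Definition missing_path := [:: (L0, L1); (L1, L2); (L2, L3)].
Definition missing_path_edge := [:: (L0, L1); (L1, L2); (L3, L4)].
Definition missing_matching := [:: (L0, L1); (L2, L3); (L4, L5)].

Definition three_edge_graphs :=
  [:: missing_triangle; missing_star; missing_path; missing_path_edge; missing_matching].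

(** Cases on how [xy] meets the path [a], [b], [c]: joining the ends gives a triangle, meeting only
    the centre a star, meeting only one end a longer path, and meeting nothing a path and a separate
    edge. *)
Lemma nonedges_share (D : {set {set 'I_10}}) (a b c x y : 'I_10) :
    a != b -> c != b -> a != c -> x != y ->
    [set x; y] != [set b; a] -> [set x; y] != [set b; c] ->
    D =i [:: [set b; a]; [set b; c]; [set x; y]] ->
  exists2 ne, ne \in three_edge_graphs & nonedges D ne.
Proof.
move=> ab cb ac xy; rewrite !eq_set2 => xyba xybc DE.
have P4 u : u != a -> u != b -> u != c ->
    D =i [:: [set b; a]; [set b; c]; [set a; u]] -> nonedges D missing_path.
  move=> ua ub uc DE'; apply: (@nonedges_label D [:: c; b; a; u] b) => [||t] //=.
    by rewrite !inE !negb_or cb !(eq_sym _ u) ua ub uc !(eq_sym _ a) ab ac.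
  by rewrite DE' !inE (setUC [set c]) orbCA.
have P4' u : u != a -> u != b -> u != c ->
    D =i [:: [set b; a]; [set b; c]; [set c; u]] -> nonedges D missing_path.
  move=> ua ub uc DE'; apply: (@nonedges_label D [:: a; b; c; u] b) => [||t] //=.
    by rewrite !inE !negb_or ab !(eq_sym _ u) ua ub uc !(eq_sym b) cb ac.
  by rewrite DE' !inE (setUC [set a]).
have K3 : D =i [:: [set b; a]; [set b; c]; [set a; c]] -> nonedges D missing_triangle.
  move=> DE'; apply: (@nonedges_label D [:: a; b; c] b) => [||t] //=.
    by rewrite !inE !negb_or ab ac eq_sym cb.
  by rewrite DE' !inE (setUC [set a] [set b]).
have K13 u : u != a -> u != b -> u != c ->
    D =i [:: [set b; a]; [set b; c]; [set b; u]] -> nonedges D missing_star.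
  move=> ua ub uc DE'; apply: (@nonedges_label D [:: a; b; c; u] b) => [||t] //=.
    by rewrite !inE !negb_or ab !(eq_sym _ u) ua ub uc !(eq_sym b) cb ac.
  by rewrite DE' !inE (setUC [set a]).
have yx : y != x by rewrite eq_sym.
have [xa|xa] := eqVneq x a.
  subst x; rewrite eqxx andTb in xyba.
  have [yc|yc] := eqVneq y c; first by rewrite yc in DE; exists missing_triangle => //; apply: K3.
  have yb : y != b by move: xyba; rewrite (negPf ab) /=.
  by exists missing_path => //; apply: (P4 y).
have [xc|xc] := eqVneq x c.
  subst x; rewrite eqxx andTb in xybc.
  have [ya|ya] := eqVneq y a.
    by rewrite ya (setUC [set c]) in DE; exists missing_triangle => //; apply: K3.
  have yb : y != b by move: xybc; rewrite (negPf cb) /=.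
  by exists missing_path => //; apply: (P4' y).
have [xb|xb] := eqVneq x b.
  subst x; move: xyba xybc; rewrite eqxx !(negPf yx) !andbF !orbF /= => ya yc.
  by exists missing_star => //; apply: (K13 y).
have [ya|ya] := eqVneq y a.
  by subst y; exists missing_path => //; apply: (P4 x) => // t; rewrite DE (setUC [set x]).
have [yc|yc] := eqVneq y c.
  by subst y; exists missing_path => //; apply: (P4' x) => // t; rewrite DE (setUC [set x]).
have [yb|yb] := eqVneq y b.
  by subst y; exists missing_star => //; apply: (K13 x) => // t; rewrite DE (setUC [set x]).
exists missing_path_edge => //; apply: (@nonedges_label D [:: a; b; c; x; y] b) => [||t] //=.
  rewrite !inE !negb_or ab ac xy !(eq_sym _ x) xa xb xc !(eq_sym _ y) ya yb yc.
  by rewrite eq_sym cb.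
by rewrite DE !inE (setUC [set a]).
Qed.

Lemma card2_mem (X : finType) (E : {set X}) b : #|E| = 2 -> b \in E ->
  exists2 a, a != b & E = [set b; a].
Proof.
move=> E2 bE; have /eqP/cards1P[a aE] : #|E :\ b| = 1.
  by have := cardsD1 b E; rewrite bE E2 => -[].
exists a; last by rewrite -aE setD1K.
by have : a \in E :\ b; [rewrite aE set11 | rewrite !inE => /andP[]].
Qed.

Lemma nonedges_meet (D : {set {set 'I_10}}) (E1 E2 E3 : {set 'I_10}) b :
    #|E1| = 2 -> #|E2| = 2 -> #|E3| = 2 -> E1 != E2 -> E3 != E1 -> E3 != E2 ->
    b \in E1 -> b \in E2 -> D =i [:: E1; E2; E3] ->
  exists2 ne, ne \in three_edge_graphs & nonedges D ne.
Proof.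
move=> c1 c2 c3 E12 E31 E32 b1 b2 DE.
have [a ab E1E] := card2_mem c1 b1; have [c cb E2E] := card2_mem c2 b2.
have /eqP/cards2P[x [y [xy E3E]]] := c3.
rewrite E1E E2E E3E in DE E12 E31 E32.
apply: nonedges_share DE => //.
by apply: contraNneq E12 => ->.
Qed.

(** Either two of the edges share a vertex, or the three form a matching. *)
Lemma three_nonedges (D : {set {set 'I_10}}) :
    #|D| = 3 -> {in D, forall E : {set 'I_10}, #|E| = 2} ->
  exists2 ne, ne \in three_edge_graphs & nonedges D ne.
Proof.
move=> D3 D2; have : 0 < #|D| by rewrite D3.
rewrite card_gt0 => /set0Pn[E1 E1D].
have /eqP/cards2P[E2 [E3 [E23 DE]]] : #|D :\ E1| = 2.
  by have := cardsD1 E1 D; rewrite E1D D3 => -[].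
have {}DE : D = [set E1; E2; E3] by rewrite -setUA -DE setD1K.
have [E2D E3D] : E2 \in D /\ E3 \in D by rewrite DE !inE !eqxx !orbT.
have [E21 E31] : E2 != E1 /\ E3 != E1.
  have : #|[set E1; E2; E3]| = 3 by rewrite -DE.
  by rewrite -setUA cardsU1 cards2 E23 !inE negb_or !(eq_sym E1); do 2!case: (_ != _).
have E32 : E3 != E2 by rewrite eq_sym.
have [[c1 c2] c3] := (D2 _ E1D, D2 _ E2D, D2 _ E3D).
have mD t : (t \in D) = [|| t == E1, t == E2 | t == E3] by rewrite DE !inE orbA.
have [/set0Pn[b]|/negPn/eqP d12] := boolP (E1 :&: E2 != set0).
  rewrite inE => /andP[b1 b2]; apply: (nonedges_meet c1 c2 c3 _ _ _ b1 b2) => //.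
    by rewrite eq_sym.
  by move=> t; rewrite mD !inE.
have [/set0Pn[b]|/negPn/eqP d13] := boolP (E1 :&: E3 != set0).
  rewrite inE => /andP[b1 b3]; apply: (nonedges_meet c1 c3 c2 _ _ _ b1 b3) => //.
    by rewrite eq_sym.
  by move=> t; rewrite mD !inE; congr (_ || _); rewrite orbC.
have [/set0Pn[b]|/negPn/eqP d23] := boolP (E2 :&: E3 != set0).
  rewrite inE => /andP[b2 b3]; apply: (nonedges_meet c2 c3 c1 _ _ _ b2 b3) => //;
    try by rewrite eq_sym.
  by move=> t; rewrite mD !inE orbC orbA.
have /eqP/cards2P[a [a' [aa' E1E]]] := c1.
have /eqP/cards2P[b [b' [bb' E2E]]] := c2.
have /eqP/cards2P[c [c' [cc' E3E]]] := c3.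
exists missing_matching => //; apply: (@nonedges_label D [:: a; a'; b; b'; c; c'] a) => [||t] //=;
  last first.
  by rewrite mD !inE E1E E2E E3E.
have dis (A B : {set 'I_10}) x y : A :&: B = set0 -> x \in A -> y \in B -> x != y.
  by move=> AB xA yB; apply/eqP => xy; move/setP/(_ x): AB; rewrite !inE xA xy yB.
have [a1 a'1] : a \in E1 /\ a' \in E1 by rewrite E1E !inE !eqxx orbT.
have [b2 b'2] : b \in E2 /\ b' \in E2 by rewrite E2E !inE !eqxx orbT.
have [cI c'I] : c \in E3 /\ c' \in E3 by rewrite E3E !inE !eqxx orbT.
pose d1 := dis _ _ _ _ d12; pose d2 := dis _ _ _ _ d13; pose d3 := dis _ _ _ _ d23.
by rewrite !inE !negb_or aa' bb' cc' (d1 _ _ a1 b2) (d1 _ _ a1 b'2) (d1 _ _ a'1 b2) (d1 _ _ a'1 b'2)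
  (d2 _ _ a1 cI) (d2 _ _ a1 c'I) (d2 _ _ a'1 cI) (d2 _ _ a'1 c'I)
  (d3 _ _ b2 cI) (d3 _ _ b2 c'I) (d3 _ _ b'2 cI) (d3 _ _ b'2 c'I).
Qed.

(** * Coordinates *)

Definition pt := (Z * Z * Z)%type.

Section RealizationCheck.
Local Open Scope Z_scope.

Definition addp (a b : pt) : pt :=
  let: (x, y, z) := a in let: (x', y', z') := b in (x + x', y + y', z + z').
Definition oppp (a : pt) : pt := let: (x, y, z) := a in (- x, - y, - z).
Definition subp a b := addp a (oppp b).
Definition dot (a b : pt) : Z :=
  let: (x, y, z) := a in let: (x', y', z') := b in x * x' + (y * y' + z * z').
Definition cross (a b : pt) : pt :=
  let: (x, y, z) := a in let: (x', y', z') := b in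
  (y * z' - z * y', z * x' - x * z', x * y' - y * x').

Variable q : vec pt.

Definition separates (t1 t2 : seq lab) (ud : pt * Z) :=
  let h i := dot (vget q i) ud.1 + ud.2 in
  all (fun i => if has (eql i) t2 then Z.eqb (h i) 0 else Z.ltb 0 (h i)) t1 &&
  all (fun i => if has (eql i) t1 then true else Z.ltb (h i) 0) t2.

(** Both orientations are offered, as the side of the first triangle is not known in advance. *)
Definition plane_through (u v : pt) : seq (pt * Z) :=
  let d := - dot u v in [:: (u, d); (oppp u, - d)].

Definition zmin (s : seq Z) := if s is x :: s' then foldr Z.min x s' else 0.
Definition zmax (s : seq Z) := if s is x :: s' then foldr Z.max x s' else 0.
(** Doubling [u] keeps the plane halfway across the gap integral. *)
Definition midplane (t1 t2 : seq lab) (u : pt) : pt * Z :=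
  let s1 := map (fun i => dot (vget q i) u) t1 in
  let s2 := map (fun i => dot (vget q i) u) t2 in
  (addp u u, - (zmin s1 + zmax s2)).

Definition sides (t : seq lab) : seq pt :=
  if t is [:: a; b; c] then
    [:: subp (vget q b) (vget q a); subp (vget q c) (vget q b); subp (vget q a) (vget q c)]
  else [::].

Fixpoint crosses (s : seq pt) : seq pt :=
  if s is u :: s' then
    flatten (map (fun v => let w := cross u v in [:: w; oppp w]) s') ++ crosses s'
  else [::].

(* Common edge: the plane spanned by it and the midpoint of the opposite vertices
   has these on different sides. Common vertex:
   the sum of the facet normals of the cone spanned by one triangle and the
   negative of the other lies inside the dual cone. Disjoint: the separating axis
   theorem, with cross products of sides as axes. *)
Definition candidates (t1 t2 : seq lab) : seq (pt * Z) :=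
  match filter (fun i => has (eql i) t2) t1, filter (fun i => ~~ has (eql i) t2) t1,
        filter (fun i => ~~ has (eql i) t1) t2 with
  | [:: a; b], [:: c], [:: d] =>
    let p := vget q a in
    plane_through (cross (subp (vget q b) p) (addp (subp (vget q c) p) (subp (vget q d) p))) p
  | [:: a], [:: b; c], [:: d; e] =>
    let p := vget q a in
    let s := [:: subp (vget q b) p; subp (vget q c) p; subp p (vget q d); subp p (vget q e)] in
    let u := foldr addp (0, 0, 0)
      (filter (fun w => all (fun g => Z.leb 0 (dot g w)) s) (crosses s)) in
    [:: (u, - dot u p)]
  | _, _, _ => map (midplane t1 t2) (crosses (sides t1 ++ sides t2))
  end.

(** Each unordered pair is tested once; negating the function serves the other order. *)
Fixpoint realizes (K : seq tri) :=
  if K is t :: K' then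
    all (fun t' => let s := seq_of_tri t in let s' := seq_of_tri t' in
           has (separates s s') (candidates s s')) K' && realizes K'
  else true.

End RealizationCheck.

(** * The twenty surfaces, grouped by their graph of non-edges *)

Section Catalogue.
Local Open Scope Z_scope.

(* Positive triangles, and the coordinates of [L0] to [L9]. *)
Definition surfaces_triangle : seq (seq tri * vec pt) :=
  [:: ([:: (L0, L1, L2); (L0, L2, L3); (L0, L3, L4); (L0, L4, L5);
      (L0, L5, L6); (L0, L6, L7); (L0, L7, L8); (L0, L8, L9);
      (L0, L9, L1); (L1, L3, L6); (L1, L4, L2); (L1, L5, L3);
      (L1, L6, L8); (L1, L7, L4); (L1, L8, L7); (L1, L9, L5);
      (L2, L4, L8); (L2, L5, L9); (L2, L6, L3); (L2, L7, L6);
      (L2, L8, L5); (L2, L9, L7); (L3, L5, L7); (L3, L7, L9);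
      (L3, L8, L4); (L3, L9, L8); (L4, L7, L5); (L5, L8, L6)],
    Vec (7, 0, 2) (0, 16, 4) (17, 19, 4) (17, 4, 14) (8, 9, 5)
      (15, 10, 9) (16, 8, 10) (14, 15, 4) (7, 9, 5) (19, 0, 19));
   ([:: (L0, L1, L2); (L0, L2, L3); (L0, L3, L4); (L0, L4, L5);
      (L0, L5, L6); (L0, L6, L7); (L0, L7, L8); (L0, L8, L9);
      (L0, L9, L1); (L1, L3, L6); (L1, L4, L2); (L1, L5, L3);
      (L1, L6, L8); (L1, L7, L4); (L1, L8, L7); (L1, L9, L5);
      (L2, L4, L9); (L2, L6, L3); (L2, L7, L6); (L2, L9, L7);
      (L3, L5, L7); (L3, L7, L9); (L3, L8, L4); (L3, L9, L8);
      (L4, L6, L9); (L4, L7, L5); (L4, L8, L6); (L5, L9, L6)],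
    Vec (14, 1, 14) (12, 10, 5) (11, 4, 10) (16, 12, 2) (2, 1, 1)
      (9, 8, 11) (7, 2, 6) (14, 14, 18) (18, 19, 1) (14, 9, 14))].

Definition surfaces_star : seq (seq tri * vec pt) :=
  [:: ([:: (L0, L1, L2); (L0, L2, L3); (L0, L3, L4); (L0, L4, L5);
      (L0, L5, L6); (L0, L6, L7); (L0, L7, L8); (L0, L8, L9);
      (L0, L9, L1); (L1, L3, L6); (L1, L4, L2); (L1, L5, L3);
      (L1, L6, L8); (L1, L7, L4); (L1, L8, L7); (L1, L9, L5);
      (L2, L4, L6); (L2, L5, L7); (L2, L6, L9); (L2, L7, L3);
      (L2, L8, L5); (L2, L9, L8); (L3, L5, L8); (L3, L7, L6);
      (L3, L8, L4); (L4, L7, L5); (L4, L8, L6); (L5, L9, L6)],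
    Vec (0, 3, 9) (1, 7, 8) (19, 17, 1) (2, 8, 8) (12, 11, 4)
      (13, 0, 18) (0, 19, 18) (0, 0, 2) (1, 12, 14) (3, 10, 15));
   ([:: (L0, L1, L2); (L0, L2, L3); (L0, L3, L4); (L0, L4, L5);
      (L0, L5, L6); (L0, L6, L7); (L0, L7, L8); (L0, L8, L9);
      (L0, L9, L1); (L1, L3, L7); (L1, L4, L2); (L1, L5, L3);
      (L1, L6, L8); (L1, L7, L6); (L1, L8, L4); (L1, L9, L5);
      (L2, L4, L6); (L2, L5, L7); (L2, L6, L9); (L2, L7, L3);
      (L2, L8, L5); (L2, L9, L8); (L3, L5, L8); (L3, L6, L4);
      (L3, L8, L6); (L4, L7, L5); (L4, L8, L7); (L5, L9, L6)],
    Vec (26, 2, 0) (9, 16, 13) (11, 11, 19) (8, 19, 9) (14, 26, 13)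
      (23, 3, 4) (26, 13, 28) (29, 18, 18) (1, 28, 0) (27, 0, 0))].

Definition surfaces_path : seq (seq tri * vec pt) :=
  [:: ([:: (L0, L1, L2); (L0, L2, L3); (L0, L3, L4); (L0, L4, L5);
      (L0, L5, L6); (L0, L6, L7); (L0, L7, L8); (L0, L8, L9);
      (L0, L9, L1); (L1, L3, L5); (L1, L4, L2); (L1, L5, L8);
      (L1, L6, L3); (L1, L7, L6); (L1, L8, L4); (L1, L9, L7);
      (L2, L4, L9); (L2, L5, L7); (L2, L7, L3); (L2, L8, L5);
      (L2, L9, L8); (L3, L6, L4); (L3, L7, L9); (L3, L9, L5);
      (L4, L6, L9); (L4, L7, L5); (L4, L8, L7); (L5, L9, L6)],
    Vec (14, 11, 19) (4, 12, 6) (2, 15, 8) (19, 4, 17) (0, 0, 2)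
      (8, 4, 5) (16, 2, 13) (10, 9, 12) (0, 11, 19) (19, 18, 1))].

Definition surfaces_path_edge : seq (seq tri * vec pt) :=
  [:: ([:: (L0, L1, L2); (L0, L2, L3); (L0, L3, L4); (L0, L4, L5);
      (L0, L5, L6); (L0, L6, L7); (L0, L7, L8); (L0, L8, L9);
      (L0, L9, L1); (L1, L3, L5); (L1, L4, L2); (L1, L5, L4);
      (L1, L6, L3); (L1, L9, L6); (L2, L4, L8); (L2, L5, L7);
      (L2, L6, L9); (L2, L7, L6); (L2, L8, L5); (L2, L9, L3);
      (L3, L6, L8); (L3, L7, L4); (L3, L8, L7); (L3, L9, L5);
      (L4, L7, L9); (L4, L9, L8); (L5, L8, L6); (L5, L9, L7)],
    Vec (4, 19, 6) (2, 6, 0) (2, 7, 6) (0, 0, 5) (5, 14, 19)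
      (4, 10, 5) (10, 3, 9) (18, 1, 11) (8, 10, 11) (13, 17, 1));
   ([:: (L0, L1, L2); (L0, L2, L3); (L0, L3, L4); (L0, L4, L5);
      (L0, L5, L6); (L0, L6, L7); (L0, L7, L8); (L0, L8, L9);
      (L0, L9, L1); (L1, L3, L6); (L1, L4, L2); (L1, L5, L3);
      (L1, L6, L4); (L1, L7, L5); (L1, L9, L7); (L2, L4, L9);
      (L2, L5, L7); (L2, L6, L3); (L2, L7, L6); (L2, L9, L5);
      (L3, L5, L8); (L3, L7, L9); (L3, L8, L7); (L3, L9, L4);
      (L4, L6, L8); (L4, L8, L5); (L5, L9, L6); (L6, L9, L8)],
    Vec (4, 11, 12) (0, 2, 0) (1, 14, 19) (5, 7, 2) (6, 19, 13)
      (4, 4, 17) (3, 15, 18) (4, 7, 13) (6, 8, 16) (11, 19, 19));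
   ([:: (L0, L1, L2); (L0, L2, L3); (L0, L3, L4); (L0, L4, L5);
      (L0, L5, L6); (L0, L6, L7); (L0, L7, L8); (L0, L8, L9);
      (L0, L9, L1); (L1, L3, L5); (L1, L4, L2); (L1, L5, L7);
      (L1, L6, L3); (L1, L7, L4); (L1, L9, L6); (L2, L4, L6);
      (L2, L5, L9); (L2, L6, L8); (L2, L7, L5); (L2, L8, L7);
      (L2, L9, L3); (L3, L6, L4); (L3, L8, L5); (L3, L9, L8);
      (L4, L7, L9); (L4, L9, L5); (L5, L8, L6); (L6, L9, L7)],
    Vec (8, 8, 6) (4, 16, 17) (25, 19, 4) (14, 5, 5) (9, 14, 5)
      (1, 18, 20) (0, 0, 2) (22, 26, 24) (20, 3, 5) (20, 22, 16));
   ([:: (L0, L1, L2); (L0, L2, L3); (L0, L3, L4); (L0, L4, L5);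
      (L0, L5, L6); (L0, L6, L7); (L0, L7, L8); (L0, L8, L9);
      (L0, L9, L1); (L1, L3, L6); (L1, L4, L2); (L1, L5, L3);
      (L1, L6, L8); (L1, L7, L4); (L1, L8, L7); (L1, L9, L5);
      (L2, L4, L8); (L2, L5, L9); (L2, L6, L3); (L2, L7, L6);
      (L2, L8, L5); (L2, L9, L7); (L3, L5, L7); (L3, L7, L9);
      (L3, L9, L4); (L4, L7, L5); (L4, L9, L8); (L5, L8, L6)],
    Vec (22, 29, 7) (18, 15, 9) (20, 11, 9) (3, 26, 0) (16, 20, 28)
      (16, 23, 10) (14, 20, 14) (16, 19, 24) (29, 29, 24) (28, 1, 10));
   ([:: (L0, L1, L2); (L0, L2, L3); (L0, L3, L4); (L0, L4, L5);
      (L0, L5, L6); (L0, L6, L7); (L0, L7, L8); (L0, L8, L9);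
      (L0, L9, L1); (L1, L3, L6); (L1, L4, L2); (L1, L5, L3);
      (L1, L6, L8); (L1, L7, L5); (L1, L8, L4); (L1, L9, L7);
      (L2, L4, L9); (L2, L5, L7); (L2, L6, L3); (L2, L7, L6);
      (L2, L9, L5); (L3, L5, L8); (L3, L7, L9); (L3, L8, L7);
      (L3, L9, L4); (L4, L8, L5); (L5, L9, L6); (L6, L9, L8)],
    Vec (4, 28, 18) (22, 15, 12) (15, 14, 29) (29, 9, 26) (29, 27, 0)
      (13, 8, 2) (18, 0, 11) (11, 14, 7) (15, 7, 4) (19, 11, 25));
   ([:: (L0, L1, L2); (L0, L2, L3); (L0, L3, L4); (L0, L4, L5);
      (L0, L5, L6); (L0, L6, L7); (L0, L7, L8); (L0, L8, L9);
      (L0, L9, L1); (L1, L3, L5); (L1, L4, L2); (L1, L5, L8);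
      (L1, L6, L3); (L1, L7, L6); (L1, L8, L4); (L1, L9, L7);
      (L2, L4, L6); (L2, L5, L7); (L2, L6, L8); (L2, L7, L9);
      (L2, L8, L5); (L2, L9, L3); (L3, L6, L4); (L3, L9, L5);
      (L4, L7, L5); (L4, L8, L7); (L5, L9, L6); (L6, L9, L8)],
    Vec (5, 9, 12) (29, 27, 9) (26, 12, 9) (11, 20, 0) (10, 23, 19)
      (1, 25, 29) (10, 18, 16) (2, 0, 15) (15, 27, 22) (1, 3, 13))].

Definition surfaces_matching : seq (seq tri * vec pt) :=
  [:: ([:: (L0, L1, L2); (L0, L2, L3); (L0, L3, L4); (L0, L4, L5);
      (L0, L5, L6); (L0, L6, L7); (L0, L7, L8); (L0, L8, L9);
      (L0, L9, L1); (L1, L3, L5); (L1, L4, L2); (L1, L5, L4);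
      (L1, L6, L3); (L1, L7, L6); (L1, L9, L7); (L2, L4, L7);
      (L2, L5, L8); (L2, L6, L9); (L2, L7, L5); (L2, L8, L6);
      (L2, L9, L3); (L3, L6, L4); (L3, L8, L5); (L3, L9, L8);
      (L4, L6, L8); (L4, L8, L7); (L5, L7, L9); (L5, L9, L6)],
    Vec (20, 28, 9) (20, 29, 25) (3, 10, 21) (0, 8, 28) (6, 14, 25)
      (0, 14, 0) (19, 13, 22) (19, 11, 4) (19, 0, 2) (27, 11, 27));
   ([:: (L0, L1, L2); (L0, L2, L3); (L0, L3, L4); (L0, L4, L5);
      (L0, L5, L6); (L0, L6, L7); (L0, L7, L8); (L0, L8, L9);
      (L0, L9, L1); (L1, L3, L5); (L1, L4, L2); (L1, L5, L7);
      (L1, L6, L3); (L1, L7, L4); (L1, L9, L6); (L2, L4, L8);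
      (L2, L5, L9); (L2, L7, L5); (L2, L8, L7); (L2, L9, L3);
      (L3, L6, L4); (L3, L8, L5); (L3, L9, L8); (L4, L6, L8);
      (L4, L7, L9); (L4, L9, L5); (L5, L8, L6); (L6, L9, L7)],
    Vec (20, 12, 12) (29, 3, 29) (17, 13, 18) (26, 24, 11) (26, 14, 25)
      (25, 28, 29) (24, 8, 19) (1, 0, 29) (14, 28, 19) (9, 5, 23));
   ([:: (L0, L1, L2); (L0, L2, L3); (L0, L3, L4); (L0, L4, L5);
      (L0, L5, L6); (L0, L6, L7); (L0, L7, L8); (L0, L8, L9);
      (L0, L9, L1); (L1, L3, L6); (L1, L4, L2); (L1, L5, L3);
      (L1, L6, L8); (L1, L7, L4); (L1, L8, L7); (L1, L9, L5);
      (L2, L4, L8); (L2, L5, L9); (L2, L6, L3); (L2, L8, L5);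
      (L2, L9, L6); (L3, L5, L7); (L3, L7, L9); (L3, L9, L4);
      (L4, L7, L5); (L4, L9, L8); (L5, L8, L6); (L6, L9, L7)],
    Vec (2, 27, 14) (19, 18, 23) (21, 17, 26) (8, 29, 4) (10, 15, 9)
      (10, 22, 10) (28, 0, 0) (22, 4, 3) (9, 17, 11) (4, 11, 16));
   ([:: (L0, L1, L2); (L0, L2, L3); (L0, L3, L4); (L0, L4, L5);
      (L0, L5, L6); (L0, L6, L7); (L0, L7, L8); (L0, L8, L9);
      (L0, L9, L1); (L1, L3, L6); (L1, L4, L2); (L1, L5, L3);
      (L1, L6, L8); (L1, L7, L5); (L1, L8, L4); (L1, L9, L7);
      (L2, L4, L9); (L2, L5, L7); (L2, L6, L3); (L2, L7, L6);
      (L2, L9, L5); (L3, L5, L8); (L3, L7, L4); (L3, L8, L7);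
      (L4, L7, L9); (L4, L8, L5); (L5, L9, L6); (L6, L9, L8)],
    Vec (19, 2, 27) (17, 28, 29) (7, 2, 29) (21, 8, 16) (8, 29, 6)
      (15, 22, 21) (24, 2, 15) (1, 0, 1) (27, 0, 15) (14, 18, 28));
   ([:: (L0, L1, L2); (L0, L2, L3); (L0, L3, L4); (L0, L4, L5);
      (L0, L5, L6); (L0, L6, L7); (L0, L7, L8); (L0, L8, L9);
      (L0, L9, L1); (L1, L3, L5); (L1, L4, L2); (L1, L5, L8);
      (L1, L6, L3); (L1, L7, L6); (L1, L8, L4); (L1, L9, L7);
      (L2, L4, L7); (L2, L5, L3); (L2, L6, L5); (L2, L7, L9);
      (L2, L9, L6); (L3, L6, L8); (L3, L7, L4); (L3, L8, L7);
      (L4, L6, L9); (L4, L8, L6); (L4, L9, L5); (L5, L9, L8)],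
    Vec (37, 4, 17) (9, 12, 28) (30, 32, 39) (7, 7, 39) (13, 12, 11)
      (12, 32, 5) (10, 28, 4) (2, 0, 0) (8, 37, 2) (30, 31, 35));
   ([:: (L0, L1, L2); (L0, L2, L3); (L0, L3, L4); (L0, L4, L5);
      (L0, L5, L6); (L0, L6, L7); (L0, L7, L8); (L0, L8, L9);
      (L0, L9, L1); (L1, L3, L5); (L1, L4, L2); (L1, L5, L4);
      (L1, L6, L8); (L1, L7, L3); (L1, L8, L7); (L1, L9, L6);
      (L2, L4, L8); (L2, L5, L7); (L2, L6, L3); (L2, L7, L6);
      (L2, L8, L5); (L3, L6, L9); (L3, L7, L4); (L3, L9, L5);
      (L4, L7, L9); (L4, L9, L8); (L5, L8, L6); (L5, L9, L7)],
    Vec (2, 28, 21) (21, 14, 12) (2, 16, 9) (29, 21, 0) (25, 20, 3)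
      (27, 1, 25) (0, 0, 2) (19, 7, 21) (7, 14, 10) (19, 3, 1));
   ([:: (L0, L1, L2); (L0, L2, L3); (L0, L3, L4); (L0, L4, L5);
      (L0, L5, L6); (L0, L6, L7); (L0, L7, L8); (L0, L8, L9);
      (L0, L9, L1); (L1, L3, L7); (L1, L4, L2); (L1, L5, L3);
      (L1, L6, L8); (L1, L7, L4); (L1, L8, L5); (L1, L9, L6);
      (L2, L4, L6); (L2, L5, L8); (L2, L6, L5); (L2, L7, L3);
      (L2, L8, L7); (L3, L5, L9); (L3, L8, L4); (L3, L9, L8);
      (L4, L7, L9); (L4, L8, L6); (L4, L9, L5); (L6, L9, L7)],
    Vec (0, 29, 28) (29, 1, 28) (13, 22, 25) (20, 4, 14) (29, 0, 16)
      (27, 2, 17) (24, 7, 23) (9, 7, 13) (17, 14, 1) (0, 9, 9));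
   ([:: (L0, L1, L2); (L0, L2, L3); (L0, L3, L4); (L0, L4, L5);
      (L0, L5, L6); (L0, L6, L7); (L0, L7, L8); (L0, L8, L9);
      (L0, L9, L1); (L1, L3, L5); (L1, L4, L2); (L1, L5, L4);
      (L1, L6, L8); (L1, L8, L3); (L1, L9, L6); (L2, L4, L9);
      (L2, L5, L7); (L2, L6, L3); (L2, L7, L6); (L2, L9, L5);
      (L3, L6, L9); (L3, L7, L5); (L3, L8, L4); (L3, L9, L7);
      (L4, L7, L9); (L4, L8, L7); (L5, L8, L6); (L5, L9, L8)],
    Vec (21, 28, 0) (20, 18, 14) (7, 22, 18) (15, 16, 12) (0, 29, 21)
      (29, 14, 25) (19, 18, 0) (4, 18, 6) (20, 22, 1) (24, 5, 26));
   ([:: (L0, L1, L2); (L0, L2, L3); (L0, L3, L4); (L0, L4, L5);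
      (L0, L5, L6); (L0, L6, L7); (L0, L7, L8); (L0, L8, L9);
      (L0, L9, L1); (L1, L4, L2); (L1, L5, L8); (L1, L6, L5);
      (L1, L7, L4); (L1, L8, L7); (L1, L9, L6); (L2, L4, L8);
      (L2, L5, L7); (L2, L6, L9); (L2, L7, L3); (L2, L8, L6);
      (L2, L9, L5); (L3, L5, L9); (L3, L6, L8); (L3, L7, L6);
      (L3, L8, L5); (L3, L9, L4); (L4, L7, L5); (L4, L9, L8)],
    Vec (0, 19, 10) (12, 15, 11) (22, 27, 0) (17, 26, 18) (14, 24, 0)
      (25, 7, 11) (1, 29, 18) (19, 15, 11) (13, 28, 20) (17, 28, 22))].

End Catalogue.

(** The labels of the graphs and of the surfaces are unrelated: in each surface [L0] is joined to
    all others, with [L1] to [L9] in cyclic order around it, while the graphs leave [L9] free. The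
    match is left to [iso_to]. *)
Definition catalogue :=
  [:: (missing_triangle, surfaces_triangle); (missing_star, surfaces_star);
      (missing_path, surfaces_path); (missing_path_edge, surfaces_path_edge);
      (missing_matching, surfaces_matching)].

Lemma catalogue_complete : all (fun g => check_pattern g.1 (unzip1 g.2)) catalogue.
Proof. vm_cast_no_check (erefl true). Qed.

Lemma catalogue_realized :
  all (fun g => all (fun r => realizes r.2 r.1) g.2) catalogue.
Proof. vm_cast_no_check (erefl true). Qed.

Lemma catalogue_checked : all (fun g =>
  check_pattern g.1 (unzip1 g.2) && all (fun r => realizes r.2 r.1) g.2) catalogue.
Proof.
by rewrite (all_predI (fun g => check_pattern _ _)) catalogue_complete catalogue_realized.
Qed.

Lemma assoc_all (A : eqType) B (P : pred (A * B)) x s :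
  x \in unzip1 s -> all P s -> exists y, P (x, y).
Proof.
elim: s => //= -[x' y] s IHs; rewrite inE => /predU1P[->|/IHs IH] /andP[] //.
by exists y.
Qed.

(** * From search leaves to catalogue entries *)

Section LeafSoundness.
Variables (N : rel 'I_10) (F : 'I_10 -> 'I_10 -> 'I_10).

(** Triangles are compared as vertex sets, because a realization ignores orientation. *)
Definition in_catalogue := exists (r : seq tri * vec pt) (s : 'I_10 -> lab),
  [/\ realizes r.2 r.1, injective s & forall a b, N a b ->
      exists2 t, t \in r.1 & [:: s a; s b; s (F a b)] =i seq_of_tri t].

Lemma all_has A (a b : pred A) s : all a s -> has b s -> exists x, a x && b x.
Proof.
elim: s => //= x s IHs /andP[ax /IHs{}IHs] /orP[bx|/IHs//].
by exists x; rewrite ax.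
Qed.

Lemma is_knownP dg e M (rs : seq (seq tri * vec pt)) :
    all (fun r => realizes r.2 r.1) rs ->
    is_known (map (mat_of false) (unzip1 rs) ++ map (mat_of true) (unzip1 rs)) M ->
  compat N F dg e M -> in_catalogue.
Proof.
rewrite /is_known has_cat !has_map => rrs rM [e_inj eM _].
have [r [fl [rr iM]]] : exists r fl, realizes r.2 r.1 /\ iso_to M (mat_of fl r.1).
  by case/orP: rM => /(all_has rrs)[r /andP[rr iM]]; exists r; [exists false | exists true].
move: iM; rewrite /iso_to => /hasP[x _ /andP[_ /hasP[y _ /andP[_]]]].
case: follow => // s /andP[/all_labP emb /all_labP s_inj].
(* The inverse labelling [f], followed by [s], carries the surface into the catalogue. *)
have [f fK] : exists f, forall i, e (f i) = i.
  exists (fun i => nth L0 labs (index i (map e labs))) => i; have il := lab_surj i e_inj.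
  by rewrite -(nth_map _ (e L0)) ?nth_index // -(size_map e) index_mem.
exists r, (fun i => vget s (f i)); split=> // i j.
  move=> /eqlP ij; have /all_labP/(_ (f j)) := s_inj (f i).
  by rewrite ij /= => /eqlP E; rewrite -(fK i) -(fK j) E.
move=> ij; have := eM (f i) (f j); have /all_labP/(_ (f j)) := emb (f i).
rewrite !fK; case: (mget M _ _) => [||c] //; first by rewrite ij.
move=> /eqcellP Gc [_ ijc]; have -> : f (F i j) = c by apply: e_inj; rewrite fK.
exact: mget_mat_of Gc.
Qed.

(** At least two open entries in each row make the truncated subtraction in [degs] exact. *)
Lemma compat_init ne e : injective e ->
    (forall a b, N (e a) (e b) = ~~ [|| eql a b, (a, b) \in ne | (b, a) \in ne]) ->
    all (fun v => 1 < count_open (vget (init ne) v)) labs ->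
  compat N F (degs (init ne)) e (init ne).
Proof.
move=> e_inj eN cnt; split=> // [a b|v].
  by rewrite /mget !vget_mk eN; case: ifP.
have := allP cnt v (mem_labs v); rewrite /degs vget_mk => c2.
rewrite -subn2 subnK // vget_mk.
have -> : count_open (vmk (fun b =>
      if [|| eql v b, (v, b) \in ne | (b, v) \in ne] then No else Un)) =
    count (fun b => N (e v) (e b)) labs.
  by rewrite /= !eN /=; do 10!case: [|| _, _ | _].
have uf : uniq (map e (filter (fun b => N (e v) (e b)) labs)).
  by rewrite map_inj_uniq // filter_uniq.
rewrite -size_filter -(size_map e) -(card_uniqP uf); apply: subset_leq_card.
by apply/subsetP => x /mapP[b]; rewrite mem_filter inE => /andP[? _] ->.
Qed.

End LeafSoundness.

(** * Transfer of separating functions from integers to reals *)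

Section RealPoints.
Local Open Scope ring_scope.
Variable R : realType.

Definition zr (z : Z) : R := (int_of_Z z)%:~R.

Lemma zrD x y : zr (Z.add x y) = zr x + zr y.
Proof. by rewrite /zr -intrD; congr (_%:~R); lia. Qed.

Lemma zrM x y : zr (Z.mul x y) = zr x * zr y.
Proof. by rewrite /zr -intrM; congr (_%:~R); lia. Qed.

Lemma zr_gt0 x : Z.ltb 0 x -> 0 < zr x.
Proof. by move=> x0; rewrite /zr ltr0z; lia. Qed.

Lemma zr_lt0 x : Z.ltb x 0 -> zr x < 0.
Proof. by move=> x0; rewrite /zr ltrz0; lia. Qed.

Definition coords (a : pt) (j : 'I_3) : R :=
  let: (x, y, z) := a in zr (nth Z0 [:: x; y; z] j).

Definition point a : 'rV[R]_3 := \row_j coords a j.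

Lemma mul_coords a b : (point a *m (\col_j coords b j)) 0 0 = zr (dot a b).
Proof.
rewrite mxE !big_ord_recl big_ord0 !mxE addr0.
by case: a b => [[x y] z] [[x' y'] z']; rewrite /= !zrD !zrM.
Qed.

Definition separable (q : vec pt) (t1 t2 : seq lab) := exists (u : 'cV[R]_3) (d : R),
  forall i, let h := (point (vget q i) *m u) 0 0 + d in
  [/\ i \in t1 -> i \in t2 -> h = 0, i \in t1 -> i \notin t2 -> 0 < h
    & i \in t2 -> i \notin t1 -> h < 0].

Lemma separableC q t1 t2 : separable q t1 t2 -> separable q t2 t1.
Proof.
move=> [u [d sep]]; exists (- u), (- d) => i h.
have -> : h = - ((point (vget q i) *m u) 0 0 + d) by rewrite /h mulmxN mxE opprD.
case: (sep i) => h0 hpos hneg; split=> i1 i2.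
- by rewrite h0 ?oppr0.
- by rewrite oppr_gt0 hneg.
- by rewrite oppr_lt0 hpos.
Qed.

Lemma separable_refl q t : separable q t t.
Proof.
exists 0, 0 => i; rewrite mulmx0 mxE addr0.
by split=> // it /negP[].
Qed.

Lemma has_eql i s : has (eql i) s = (i \in s).
Proof. by rewrite -has_pred1; apply: eq_has => j; rewrite /= eq_sym. Qed.

Lemma separatesP q t1 t2 ud : separates q t1 t2 ud -> separable q t1 t2.
Proof.
case: ud => u d /andP[/allP sep1 /allP sep2].
exists (\col_j coords u j), (zr d) => i; rewrite mul_coords -zrD.
split=> i1 i2; have := (sep1 i, sep2 i); rewrite !has_eql ?i1 ?(negPf i2) ?i2.
- by case=> /(_ isT)/Z.eqb_eq-> _.
- by case=> /(_ isT)/zr_gt0.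
- by case=> _ /(_ isT)/zr_lt0.
Qed.

Lemma realizesP q K : realizes q K ->
  {in K &, forall t1 t2, separable q (seq_of_tri t1) (seq_of_tri t2)}.
Proof.
elim: K => //= t K IHK /andP[/allP sept /IHK{}IHK] t1 t2.
have septP t' : t' \in K -> separable q (seq_of_tri t) (seq_of_tri t').
  by move=> /sept/hasP[ud _]; apply: separatesP.
rewrite !inE => /predU1P[->|t1K] /predU1P[->|t2K]; last exact: IHK.
- exact: separable_refl.
- exact: septP.
- exact/separableC/septP.
Qed.

End RealPoints.

Theorem mainTheorem1 (R : realType) (T : {set {set 'I_10}}) :
  genus_surface T 3 -> exists p : 'I_10 -> 'rV[R]_3, geometric_realization T p.
Proof.
case=> T3 Tcov T2 Tlink [_ [eps [eps1 eps0]] euler].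
pose N := nbr T; pose F := nxt T eps.
set D := [set E : {set 'I_10} | #|E| == 2] :\: edges T.
(* From [2E = 3T] and [10 - E + T = -4] follows [E = 42], out of 45 pairs. *)
have D3 : #|D| = 3.
  have ET := edges_faces T3 T2; rewrite cardsD card_draws card_ord.
  rewrite (setIidPr _); last by apply/subsetP => E; rewrite !inE => /andP[].
  have -> : 'C(10, 2) = 45 by [].
  by move: ET euler; move: #|edges T| #|T| => m k; lia.
have [|ne nec [e e_inj eD]] := three_nonedges D3.
  by move=> E; rewrite !inE => /andP[_ /eqP].
have eN a b : N (e a) (e b) = ~~ [|| eql a b, (a, b) \in ne | (b, a) \in ne].
  rewrite -eD !inE cards2 -[eql a b]/(a == b) /N nbrP (inj_eq e_inj).
  by case: (a == b); case: is_face.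
have N_cat : in_catalogue N F.
  have [rs /andP[chk rrs]] :=
    @assoc_all _ _ _ ne catalogue nec catalogue_checked.
  have /andP[deg_ne srch] := chk.
  have F_nbr := nxt_nbr T3 T2 eps1 eps0; have FK := nxtK T3 T2 eps1 eps0.
  have F_orbit v x k := @nxt_orbit _ _ _ T3 T2 Tlink eps1 eps0 v x k.
  apply: (searchP F_nbr FK F_orbit _ srch (compat_init F e_inj eN deg_ne)) => f M.
  exact: is_knownP rrs.
have [[K q] [s [/= /(realizesP R) sepK s_inj sK]]] := N_cat.
exists (fun i => point R (vget q (s i))).
(* Mapping the triangles of [T] into [K] suffices, since [separated] concerns only pairs of
   triangles of [T]. *)
have KT t : t \in T -> exists2 t', t' \in K & forall i, (i \in t) = (s i \in seq_of_tri t').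
  move=> /(tri_nxt T3 T2 eps1 eps0)[a [b [ab ->]]].
  have [t' t'K st'] := sK a b ab; exists t' => // i.
  by rewrite -st' !inE !(inj_eq s_inj) orbA.
apply: separated_realization => //; last exact: surface_neighbourly.
move=> t1 t2 /KT[t1' t1K t1E] /KT[t2' t2K t2E].
have [u [d sep]] := sepK _ _ t1K t2K; exists u, d => h.
by split=> i; rewrite !inE !t1E !t2E => /andP[i1 i2]; case: (sep (s i)) => h0 hpos hneg; auto.
Qed.
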